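(* Suppose that the sampling time $T>0$ is non-pathological for $A$: with $\lambda_1,\dots,\lambda_n$ the eigenvalues of $A$ and $i$ the imaginary unit, $\lambda_j-\lambda_l\neq \frac{2q\pi}{T}i$ for any distinct $j,l\in\{1,\dots,n\}$ and any positive integer $q$. Let $N=n+m$. Design the piecewise constant input $u(t+kT)=\mu_k$ ($t\in[0,T)$, $k=0,\dots,N-1$) for the system as follows. At time $t=0$, select a nonzero $\mu_0\in\mathbb{R}^m$. At time $t=kT$, for $k\in\{1,2,\dots,N-1\}$: - if $\chi_k\notin\operatorname{im}\chi_{[0,k-1]}$, select $\mu_k\in\mathbb{R}^m$ arbitrarily; - if $\chi_k\in\operatorname{im}\chi_{[0,k-1]}$, then there exist $\xi\in\mathbb{R}^n$ and $\eta\in\mathbb{R}^m$ with $\eta\neq 0$ such that $$\begin{bmatrix}\xi^\top&\eta^\top\end{bmatrix}\begin{bmatrix}\chi_{[0,k-1]}\\ \mu_{[0,k-1]}\end{bmatrix}=0,$$ and in this case select $\mu_k$ such that $\xi^\top\chi_k+\eta^\top\mu_k\neq 0$. Then the resulting trajectory $(u,x)$ on $[0,(n+m)T)$ satisfies $$\operatorname{rank}\begin{bmatrix}\chi_{[0,N-1]}\\ \mu_{[0,N-1]}\end{bmatrix}=n+m.$$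
   Context: Consider the linear system $\dot x(t)=Ax(t)+Bu(t)$, $x(0)=x_0$, with $A\in\mathbb{R}^{n\times n}$, $B\in\mathbb{R}^{n\times m}$, $(A,B)$ controllable. A trajectory on $[0,NT)$ is a pair $(u,x)$ with $u:[0,NT)\to\mathbb{R}^m$ piecewise continuous, $x:[0,NT)\to\mathbb{R}^n$ absolutely continuous, satisfying the system equation for almost all $t\in[0,NT)$. Sampled data: $\chi_k=x(kT)\in\mathbb{R}^n$ (which depends only on $x_0$ and $\mu_0,\dots,\mu_{k-1}$), $\chi_{[0,k-1]}=[\chi_0\ \cdots\ \chi_{k-1}]\in\mathbb{R}^{n\times k}$ and $\mu_{[0,k-1]}=[\mu_0\ \cdots\ \mu_{k-1}]\in\mathbb{R}^{m\times k}$; $\operatorname{im}$ denotes the column space. *)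

(* Defs.v *)
From HB Require Import structures.
From mathcomp Require Export all_boot all_order all_algebra.
From mathcomp Require Export all_classical all_reals all_analysis.
From mathcomp Require Export complex.
Export Order.TTheory GRing.Theory Num.Theory.
Export numFieldNormedType.Exports.

Set Implicit Arguments.
Unset Strict Implicit.
Unset Printing Implicit Defensive.

Local Open Scope classical_set_scope.
Local Open Scope ring_scope.

Section Trajectories.
Context {R : realType}.

(* Functions on [0, L) are represented by total functions on R whose values
   outside [0, L) are never constrained nor used. *)

(* Continuous on (0, L) except at finitely many points, with finite one-sided
   limits at every point of [0, L). *)
Definition piecewise_continuous (m : nat) (L : R) (u : R -> 'cV[R]_m) : Prop :=
  [/\ exists s : seq R,
        forall t : R, 0 < t < L -> t \notin s -> {for t, continuous u},
      forall t : R, 0 <= t < L -> cvg (u @ t^'+)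
    & forall t : R, 0 < t < L -> cvg (u @ t^'-)].

Definition absolutely_continuous_on (n : nat) (L : R) (x : R -> 'cV[R]_n) : Prop :=
  forall e : R, 0 < e -> exists2 d : R, 0 < d &
    forall (p : nat) (a b : 'I_p -> R),
      (forall i, 0 <= a i /\ a i <= b i /\ b i < L) ->
      trivIset setT (fun i => `]a i, b i[%classic) ->
      \sum_(i < p) (b i - a i) < d ->
      \sum_(i < p) `|x (b i) - x (a i)| < e.

Definition trajectory (n m : nat) (A : 'M[R]_n) (B : 'M[R]_(n, m))
    (x0 : 'cV[R]_n) (L : R) (u : R -> 'cV[R]_m) (x : R -> 'cV[R]_n) : Prop :=
  [/\ piecewise_continuous L u,
      absolutely_continuous_on L x,
      x 0 = x0
    & {ae (@lebesgue_measure R), forall t : R, 0 <= t < L ->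
         is_derive t (1 : R) x (A *m x t + B *m u t)}].

(* Every state can be steered to every other state in finite time. *)
Definition controllable (n m : nat) (A : 'M[R]_n) (B : 'M[R]_(n, m)) : Prop :=
  forall x0 x1 : 'cV[R]_n,
    exists (L tf : R) (u : R -> 'cV[R]_m) (x : R -> 'cV[R]_n),
      [/\ 0 < tf < L, trajectory A B x0 L u x & x tf = x1].

(* lam lists the complex eigenvalues of A with algebraic multiplicity. *)
Definition eigenvalues_of (n : nat) (A : 'M[R]_n) (lam : 'I_n -> R[i]) : Prop :=
  char_poly (map_mx (real_complex R) A) = \prod_(j < n) ('X - (lam j)%:P).

Definition non_pathological (n : nat) (A : 'M[R]_n) (T : R) : Prop :=
  forall lam : 'I_n -> R[i], eigenvalues_of A lam ->
  forall j l : 'I_n, j <> l -> forall q : nat, (0 < q)%N ->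
    lam j - lam l <> (0 +i* (2 * q%:R * pi / T))%C.

End Trajectories.

Section SampledData.
Context {R : realType}.

(* [v_0 ... v_(k-1)] *)
Definition hcat (p : nat) (v : nat -> 'cV[R]_p) (k : nat) : 'M[R]_(p, k) :=
  \matrix_(i < p, j < k) v j i 0.

Definition im (p k : nat) (M : 'M[R]_(p, k)) : set 'cV[R]_p :=
  [set M *m c | c in [set: 'cV[R]_k]].

Definition data_matrix (n m : nat) (chi : nat -> 'cV[R]_n) (mu : nat -> 'cV[R]_m)
    (k : nat) : 'M[R]_(n + m, k) :=
  col_mx (hcat chi k) (hcat mu k).

Definition annihilates (n m : nat) (chi : nat -> 'cV[R]_n) (mu : nat -> 'cV[R]_m)
    (k : nat) (xi : 'cV[R]_n) (eta : 'cV[R]_m) : Prop :=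
  row_mx xi^T eta^T *m data_matrix chi mu k = 0.

(* The requirement on mu_k; for k > 0 it is void when chi_k is not in the
   column space of the previous states. *)
Definition design_step (n m : nat) (chi : nat -> 'cV[R]_n) (mu : nat -> 'cV[R]_m)
    (k : nat) : Prop :=
  if k is 0 then mu 0%N <> 0
  else im (hcat chi k) (chi k) ->
    exists (xi : 'cV[R]_n) (eta : 'cV[R]_m),
      [/\ eta <> 0,
          annihilates chi mu k xi eta
        & xi^T *m chi k + eta^T *m mu k <> 0].

End SampledData.

(* Main.v *)
Require Import Defs.
From mathcomp Require Import ring lra.
Local Open Scope classical_set_scope.
Local Open Scope ring_scope.
Set Implicit Arguments.
Unset Strict Implicit.
Unset Printing Implicit Defensive.

(** Under an input held at mu_k, the pair (x, u) solves z' = M z with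
    M = [[A, B], [0, 0]].  Put E = exp(TM).  The data columns then satisfy
    (chi_(k+1), mu_k) = E (chi_k, mu_k) ([trajectory_hold]), with no need for
    the integral that defines the sampled input matrix.

    The key fact ([sampled_left_kernel]) is that a space of row vectors (v, 0)
    that is stable under E must be zero; this is controllability of the sampled
    system.  Over the complex numbers such a nonzero space contains an
    eigenvector (v, 0) of E.  Distinct eigenvalues of M have distinct images
    under lam |-> exp(lam T): for two eigenvalues of A this is the hypothesis
    on T, and for an eigenvalue of A against the eigenvalue 0 of M it is the
    same hypothesis applied to that eigenvalue and its conjugate.  Hence every
    eigenvector of E is an eigenvector of M ([expmx_eigenspace]), so that
    v A = lam v and v B = 0.  Along any trajectory v x then solves the scalar
    equation y' = lam y; started from 0 it stays 0, whereas controllability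
    makes every state reachable ([controllable_left_kernel]).

    Suppose now that chi_k lies in the span X of chi_0, ..., chi_(k-1) and that
    every (xi, eta) that annihilates the data has eta = 0.  Let V be the
    annihilator of X.  The rows (v, 0) with v in V are exactly the annihilators
    of the data columns, and E maps them to annihilators again because
    chi_1, ..., chi_k all lie in X.  So V = 0 by the key fact, no nonzero row
    annihilates the k columns, and k >= n + m.  This gives the required
    (xi, eta) for k < n + m ([informative_annihilator]).  The choice of mu_k
    makes each new data column independent of the previous ones
    ([design_free]), whence the rank.

    Solutions are only absolutely continuous and satisfy the equation almost
    everywhere, so uniqueness rests on the theorem that an absolutely continuous
    function whose derivative vanishes almost everywhere is constant
    ([ac_ae_derive0_cst]), applied to exp(-tM) z(t). *)

(** * Real series sum f_k t^k / k! and the matrix exponential *)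

Section ExponentialGeneratingFunctions.
Context {R : realType}.
Implicit Types (f : nat -> R) (t : R).

Definition geom_bounded f :=
  exists C c : R, [/\ 0 <= C, 0 <= c & forall k, `|f k| <= C * c ^+ k].

Definition egf f t : R := limn (pseries (fun k => f k / k`!%:R) t).

(** The terms are dominated by those of C exp(c |t|). *)
Lemma is_cvg_egf f t :
  geom_bounded f -> cvgn (pseries (fun k => f k / k`!%:R) t).
Proof.
move=> [C [c [C0 c0 fc]]]; apply: normed_cvg.
apply: (@series_le_cvg _ _ (fun k => C * exp_coeff (c * `|t|) k)) => [k|k|k|].
- exact: normr_ge0.
- by rewrite mulr_ge0// exp_coeff_ge0// mulr_ge0.
- rewrite /exp_coeff /= !normrM normrX normfV.
  rewrite (ger0_norm (ler0n _ _)) exprMn mulrAC !mulrA.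
  by rewrite ler_wpM2r ?invr_ge0 ?ler0n// ler_wpM2r ?exprn_ge0.
- apply: (@is_cvg_seriesZ _ _ C); exact: is_cvg_series_exp_coeff.
Qed.

Lemma geom_bounded_shift f : geom_bounded f -> geom_bounded (fun k => f k.+1).
Proof.
move=> [C [c [C0 c0 fc]]]; exists (C * c), c; split; rewrite ?mulr_ge0// => k.
by apply: le_trans (fc _) _; rewrite exprS mulrA.
Qed.

Lemma geom_boundedZ a f : geom_bounded f -> geom_bounded (fun k => a * f k).
Proof.
move=> [C [c [C0 c0 fc]]]; exists (`|a| * C), c; split; rewrite ?mulr_ge0// => k.
by rewrite normrM -mulrA ler_wpM2l.
Qed.

Lemma egf0 f : egf f 0 = f 0.
Proof.
apply: cvg_lim => //; rewrite -cvg_shiftS.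
apply: cvg_near_cst; apply: nearW => n /=.
rewrite /pseries /series /= big_nat_recl// big1 ?addr0 => [|k _].
  by rewrite expr0 mulr1 fact0 divr1.
by rewrite exprS mul0r mulr0.
Qed.

Lemma egfZ a f t : geom_bounded f -> egf (fun k => a * f k) t = a * egf f t.
Proof.
move=> /is_cvg_egf fb; rewrite /egf.
apply: cvg_lim => //.
rewrite (_ : pseries _ t = (fun n => a *: pseries (fun k => f k / k`!%:R) t n)).
  by apply: cvgZl_tmp; exact: fb.
apply/funext => n; rewrite /pseries/series/= scaler_sumr.
by apply: eq_bigr => i _; rewrite -!mulrA.
Qed.

Lemma egf_sum (I : finType) (F : I -> nat -> R) t :
  (forall i, geom_bounded (F i)) ->
  egf (fun k => \sum_i F i k) t = \sum_i egf (F i) t.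
Proof.
move=> Fb; apply: cvg_lim => //.
rewrite (_ : pseries _ t =
  (fun n => \sum_i pseries (fun k => F i k / k`!%:R) t n)).
  by apply: cvg_big => [|i _]; [exact: add_continuous|exact: is_cvg_egf].
apply/funext => n; rewrite /pseries/series/= exchange_big/=.
by apply: eq_bigr => k _; rewrite mulr_suml mulr_suml.
Qed.

Lemma pseries_diffs_egf f :
  pseries_diffs (fun k => f k / k`!%:R) = (fun k => f k.+1 / k`!%:R).
Proof.
apply/funext => k; rewrite /pseries_diffs factS natrM invfM mulrCA.
by rewrite mulVKf// pnatr_eq0.
Qed.

(** Term by term differentiation shifts the coefficients; it needs convergence
    at a point beyond t of the series and of its first two derived series. *)
Lemma is_derive_egf f t :
  geom_bounded f -> is_derive t (1 : R) (egf f) (egf (fun k => f k.+1) t).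
Proof.
move=> fb; have fb1 := geom_bounded_shift fb.
have fb2 := geom_bounded_shift fb1.
rewrite /egf -pseries_diffs_egf.
apply: (@pseries_snd_diffs _ _ (`|t| + 1));
  rewrite ?pseries_diffs_egf ?(pseries_diffs_egf (fun k => f k.+1)).
- exact: is_cvg_egf.
- exact: is_cvg_egf.
- exact: is_cvg_egf.
- by rewrite [ltRHS]ger0_norm ?addr_ge0// ltrDl.
Qed.
End ExponentialGeneratingFunctions.

Lemma is_derive_mxP {R : realType} {m n : nat} (F : R -> 'M[R]_(m, n))
    (D : 'M[R]_(m, n)) (t : R) :
  is_derive t (1 : R) F D <->
  forall i j, is_derive t (1 : R) (fun s => F s i j) (D i j).
Proof.
split=> [[dF <-] i j|dF].
  by apply: DeriveDef; [move/derivable_mxP : dF; exact|rewrite derive_mx// mxE].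
have dF' : derivable F t 1 by apply/derivable_mxP => i j; case: (dF i j).
apply: DeriveDef => //; rewrite derive_mx//; apply/matrixP => i j.
by rewrite mxE; case: (dF i j).
Qed.

Lemma is_derive_mulmx {R : realType} {m n p : nat} (F : R -> 'M[R]_(m, n))
    (G : R -> 'M[R]_(n, p)) F' G' (t : R) :
  is_derive t (1 : R) F F' -> is_derive t (1 : R) G G' ->
  is_derive t (1 : R) (fun s => F s *m G s) (F' *m G t + F t *m G').
Proof.
move=> /is_derive_mxP dF /is_derive_mxP dG; apply/is_derive_mxP => i j.
have h := is_derive_sum (fun l => is_deriveM (dF i l) (dG l j)).
rewrite !mxE -big_split/=.
rewrite (_ : (fun s => _) =
    \sum_(l < n) ((fun s => F s i l) * (fun s => G s l j))).
  apply: is_derive_eq h _; apply: eq_bigr => l _; rewrite addrC.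
  by congr (_ + _); exact: mulrC.
by apply/funext => s; rewrite fct_sumE !mxE.
Qed.

Section MatrixExponential.
Context {R : realType} {n : nat}.
Implicit Types (A : 'M[R]_n) (s t : R).

Definition expmx A t : 'M[R]_n :=
  \matrix_(i, j) egf (fun k => (A ^+ k) i j) t.

(** The sum c of all |A i j| bounds every column sum, so c^k bounds the entries
    of A^k. *)
Lemma geom_bounded_expmx A i j : geom_bounded (fun k => (A ^+ k) i j).
Proof.
pose c := \sum_i \sum_j `|A i j|.
have cA l : \sum_i `|A i l| <= c.
  by apply: ler_sum => a _; rewrite (bigD1 l)//= lerDl sumr_ge0.
have c0 : 0 <= c by apply: sumr_ge0 => *; exact: sumr_ge0.
exists 1, c; split => // k; rewrite mul1r.
elim: k j => [|k IH] j.
  by rewrite !expr0 mxE; case: (i == j); rewrite ?normr1 ?normr0.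
rewrite exprSr mxE (le_trans (ler_norm_sum _ _ _))//.
rewrite exprSr (le_trans _ (ler_wpM2l (exprn_ge0 k c0) (cA j)))//.
rewrite mulr_sumr ler_sum// => l _.
by rewrite normrM ler_wpM2r.
Qed.

Lemma expmx0 A : expmx A 0 = 1%:M.
Proof. by apply/matrixP => i j; rewrite mxE egf0 expr0. Qed.

(** Shifting the exponent multiplies by A on either side: this yields both the
    derivative of the exponential and its commutation with A. *)
Lemma egf_expmx_mull A t i j :
  egf (fun k => (A ^+ k.+1) i j) t = (A *m expmx A t) i j.
Proof.
rewrite mxE (_ : (fun k => _) = fun k => \sum_l A i l * (A ^+ k) l j); last first.
  by apply/funext => k; rewrite exprS mxE.
rewrite egf_sum => [|l]; last exact/geom_boundedZ/geom_bounded_expmx.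
by apply: eq_bigr => l _; rewrite egfZ ?mxE//; exact: geom_bounded_expmx.
Qed.

Lemma egf_expmx_mulr A t i j :
  egf (fun k => (A ^+ k.+1) i j) t = (expmx A t *m A) i j.
Proof.
rewrite mxE (_ : (fun k => _) = fun k => \sum_l A l j * (A ^+ k) i l); last first.
  by apply/funext => k; rewrite exprSr mxE; apply: eq_bigr => l _; rewrite mulrC.
rewrite egf_sum => [|l]; last exact/geom_boundedZ/geom_bounded_expmx.
by apply: eq_bigr => l _; rewrite egfZ 1?mulrC ?mxE//; exact: geom_bounded_expmx.
Qed.

Lemma expmxC A t : expmx A t *m A = A *m expmx A t.
Proof. by apply/matrixP => i j; rewrite -egf_expmx_mulr egf_expmx_mull. Qed.

Lemma is_derive_expmx A t :
  is_derive t (1 : R) (expmx A) (A *m expmx A t).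
Proof.
apply/is_derive_mxP => i j; rewrite -egf_expmx_mull.
rewrite (_ : (fun t => _) = egf (fun k => (A ^+ k) i j)).
  by apply: is_derive_egf; exact: geom_bounded_expmx.
by apply/funext => s; rewrite mxE.
Qed.

Lemma is_derive_expmxN A t :
  is_derive t (1 : R) (fun t => expmx A (- t)) (- (A *m expmx A (- t))).
Proof.
apply/is_derive_mxP => i j.
have /is_derive_mxP/(_ i j) h := is_derive_expmx A (- t).
have := @is_derive1_comp _ (fun t => expmx A t i j) (-%R) t _ _ h _.
move=> /(_ _ (is_deriveN (is_derive_id _ _))) hN.
by apply: is_derive_eq hN _; rewrite mulrN1 [in RHS]mxE.
Qed.

(** The product has zero derivative, since A commutes with its exponential. *)
Lemma expmxNK A t : expmx A (- t) *m expmx A t = 1%:M.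
Proof.
apply/matrixP => i j.
transitivity ((expmx A (- 0) *m expmx A 0) i j); last first.
  by rewrite oppr0 expmx0 mulmx1.
apply: (@is_derive_0_is_cst _ (fun s => (expmx A (- s) *m expmx A s) i j)) => s.
have /is_derive_mxP/(_ i j) :=
  is_derive_mulmx (is_derive_expmxN A s) (is_derive_expmx A s).
by rewrite -expmxC mulmxA mulNmx addNr mxE.
Qed.
End MatrixExponential.

(** * Absolutely continuous functions with almost everywhere null derivative *)

Section AbsoluteContinuity.
Context {R : realType}.
Implicit Types (a c t : R) (s : seq (R * R)).

(** Intervals listed from right to left, so that extending a family to the
    right is a [cons]. *)
Fixpoint chain a c s : Prop :=
  if s is p :: s' then [/\ p.1 <= p.2, p.2 <= c & chain a p.1 s'] else a <= c.

Definition total_length s : R := \sum_(p <- s) (p.2 - p.1).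

Definition total_increment (V : normedModType R) (f : R -> V) s : R :=
  \sum_(p <- s) `|f p.2 - f p.1|.

Definition ac_segment (V : normedModType R) a c (f : R -> V) :=
  forall e : R, 0 < e -> exists2 d : R, 0 < d &
    forall s, chain a c s -> total_length s < d -> total_increment f s < e.

Lemma chain_widen a c c' s : c <= c' -> chain a c s -> chain a c' s.
Proof.
by case: s => [|p s] /= cc' => [ac|[p12 pc ps]]; [|split]; rewrite ?(le_trans _ cc').
Qed.

Lemma chain_le a c s : chain a c s -> a <= c.
Proof.
elim: s c => [//|p s IH] c /= [p12 pc /IH ap].
by rewrite (le_trans ap)// (le_trans p12).
Qed.

Lemma derive0_locally_flat (f : R -> R) (m e : R) : 0 < e -> is_derive m 1 f 0 ->
  exists2 r : R, 0 < r & forall t, `|t - m| < r -> `|f t - f m| <= e * `|t - m|.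
Proof.
move=> e0 [df df0].
have : h^-1 *: (f (h *: 1 + m) - f m) @[h --> 0^'] --> 'D_1 f m by exact: df.
rewrite df0 => /cvgrPdist_le/(_ _ e0)[r /= r0 hr].
exists r => // t tmr; have [->|tm] := eqVneq t m; first by rewrite !subrr !normr0 mulr0.
have tm0 : t - m != 0 by rewrite subr_eq0.
have := hr (t - m); rewrite /ball_/= !sub0r !normrN => /(_ tmr tm0).
rewrite [(t - m)%:A]mulr1 subrK normrM normfV mulrC ler_pdivrMr ?normr_gt0//.
Qed.

(** Fix e and let d be its modulus of absolute continuity.  An open U of measure
    less than d contains the bad points.  Moving t from a to c, keep the bound
    |f t - f a| <= e (t - a) + (increment of f on a chain of total length at
    most the measure of U below t).  Each point m has a neighbourhood across which
    the bound propagates: if m is in U, add the step to the chain; otherwise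
    f' m = 0 and the step costs at most e times its length.  A supremum argument
    reaches c, where the chain contributes less than e. *)
Lemma ac_ae_derive0_cst a c (f : R -> R) : a <= c -> ac_segment a c f ->
  {ae (@lebesgue_measure R), forall t, a < t < c -> is_derive t 1 f 0} ->
  f c = f a.
Proof.
move=> ac acf [N [mN N0 fN]].
apply/eqP; rewrite -subr_eq0 -normr_le0; apply/ler_addgt0Pl => e' e'0; rewrite addr0.
have ca1 : 0 < c - a + 1 by rewrite ltr_wpDl// subr_ge0.
(* The final bound is e (c - a) + e, hence the factor c - a + 1. *)
pose e := e' / (c - a + 1).
have e0 : 0 < e by rewrite divr_gt0.
have [d d0 hd] := acf _ e0.
pose mu : {measure set (measurableTypeR R) -> \bar R} := lebesgue_measure.
(* The end points are bad too: differentiability is given in ]a, c[ only. *)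
pose N' := N `|` [set a; c].
have mN' : measurable N'.
  apply: measurableU => //; apply: measurableU; exact: measurable_set1.
have N'0 : mu N' = 0%E.
  apply: null_set_setU => //.
  - apply: measurableU; exact: measurable_set1.
  - by apply: null_set_setU;
      [exact: measurable_set1..|exact: lebesgue_measure_set1|
       exact: lebesgue_measure_set1].
have [U [oU N'U muUN]] : exists U, [/\ open U, N' `<=` U & (mu (U `\` N') < d%:E)%E].
  apply: lebesgue_regularity_outer => //.
  by change (mu N' < +oo)%E; rewrite N'0.
have mU : measurable U by exact: measurable_realfun.open_measurable.
have muU : (mu U < d%:E)%E.
  have -> : (mu U = mu N' + mu (U `\` N'))%E.
    rewrite -[in LHS](setDUK N'U) measureU//; first exact: measurableD.
    by rewrite setDIK.
  by rewrite N'0 add0e.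
have mu_itv t t' : ((t' - t)%:E <= mu `]t, t'[%classic)%E.
  have := lebesgue_measure_itv `]t, t'[; rewrite /= => mE.
  rewrite [leRHS](_ : _ = if (t%:E < t'%:E)%E then (t' - t)%:E else 0%E) ?mE//.
  by case: ifPn => //; rewrite lte_fin -leNgt lee_fin subr_le0.
pose good t := a <= t <= c /\ exists s, [/\ chain a t s,
  ((total_length s)%:E <= mu (U `&` `]-oo, t[%classic))%E &
  `|f t - f a| <= e * (t - a) + total_increment f s].
have step m : a <= m <= c -> exists2 r : R, 0 < r & forall t t',
    m - r < t -> t <= m -> m <= t' -> t' <= c -> t' < m + r -> good t -> good t'.
  move=> /andP[am mc]; have [Um|Um] := pselect (U m).
  - have [r /= r0 rU] := (nbhs_ballP _ _).1 (open_nbhs_nbhs (conj oU Um)).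
    exists r => // t t' rt tm mt' t'c t'r [/andP[at_ tc] [s [cs ls ds]]].
    have tt' : t <= t' by rewrite (le_trans tm).
    split; first by rewrite t'c (le_trans at_).
    exists ((t, t') :: s); split=> //=.
    + rewrite /total_length big_cons/= -/(total_length s) EFinD.
      apply: (@le_trans _ _ (mu (`]t, t'[%classic `|` (U `&` `]-oo, t[%classic)))).
        rewrite measureU//.
        * by rewrite leeD// mu_itv.
        * exact: measurableI.
        * apply/seteqP; split=> // z [/=]; rewrite !in_itv/= => /andP[tz _] [_ zt].
          by have := lt_trans tz zt; rewrite ltxx.
      apply: le_measure; rewrite ?inE//.
      * by apply: measurableU => //; exact: measurableI.
      * exact: measurableI.
      * move=> z [|[Uz]]/=; rewrite !in_itv/=.
          move=> /andP[tz zt']; split=> //; apply: rU.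
          by rewrite /ball/= ltr_distlC; apply/andP; split; lra.
        by move=> zt; split=> //; exact: lt_le_trans tt'.
    + rewrite /total_increment big_cons/= -/(total_increment f s).
      have := ler_normD (f t' - f t) (f t - f a); rewrite subrKA.
      have : e * (t - a) <= e * (t' - a) by rewrite ler_wpM2l ?(ltW e0)// lerD2r.
      lra.
  - have amc : a < m < c.
      by rewrite !lt_neqAle am mc !andbT; apply/andP; split; apply/eqP => mE;
        apply: Um; apply: N'U; right; [left|right]; rewrite ?mE -?mE.
    have dm : is_derive m 1 f 0.
      apply: contrapT => dm; apply: Um; apply: N'U; left; apply: fN => /=.
      by move/(_ amc).
    have [r r0 hr] := derive0_locally_flat e0 dm.
    exists r => // t t' rt tm mt' t'c t'r [/andP[at_ tc] [s [cs ls ds]]].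
    have tt' : t <= t' by rewrite (le_trans tm).
    split; first by rewrite t'c (le_trans at_).
    exists s; split.
    + exact: chain_widen cs.
    + apply: le_trans ls _; apply: le_measure; rewrite ?inE; [exact: measurableI..|].
      by move=> z [Uz]/=; rewrite !in_itv/= => zt; split=> //; exact: lt_le_trans tt'.
    + have := hr t; have := hr t'.
      rewrite (ler0_norm (_ : t - m <= 0)) ?subr_le0//.
      rewrite (ger0_norm (_ : 0 <= t' - m)) ?subr_ge0//.
      have := ler_normD (f t' - f m) (f m - f a); rewrite subrKA.
      have := ler_normD (f m - f t) (f t - f a); rewrite subrKA (distrC (f m) (f t)).
      move=> h1 h2 /(_ ltac:(lra)) h3 /(_ ltac:(lra)) h4.
      lra.
have gooda : good a.
  split; first by rewrite lexx.
  exists [::]; rewrite /total_length/total_increment !big_nil/=.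
  by rewrite !subrr normr0 mulr0 addr0.
have supS : has_sup [set t | good t].
  by split; [exists a|exists c => t [/andP[_]]].
pose m := sup [set t | good t].
have am : a <= m by apply: ub_le_sup => //; case: supS.
have mc : m <= c by apply: ge_sup; [case: supS|move=> t [/andP[]]].
have [r r0 hr] := step m ltac:(by rewrite am mc).
have [t gt mrt] := sup_adherent r0 supS.
have tm : t <= m by apply: ub_le_sup => //; case: supS.
have goodc : good c.
  pose t' := Num.min c (m + r / 2).
  have mt' : m <= t' by rewrite le_min mc lerDl divr_ge0 ?ltW.
  have gt' : good t'.
    apply: hr gt => //; first by rewrite ge_min lexx.
    by rewrite gt_min ltrD2l gtr_pMr// invf_lt1// ltr1n orbT.
  have : t' <= m by apply: ub_le_sup => //; case: supS.
  rewrite ge_min; case/orP => [cm|]; last by rewrite gerDl leNgt divr_gt0.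
  have <- : t' = c; last by [].
  by apply/min_idPl; rewrite (le_trans cm)// lerDl divr_ge0 ?ltW.
have [_ [s [cs ls ds]]] := goodc.
have /(hd _ cs) : total_length s < d.
  rewrite -lte_fin (le_lt_trans ls)// (le_lt_trans _ muU)//.
  by apply: le_measure; rewrite ?inE//; exact: measurableI.
have e'E : e' = e * (c - a + 1) by rewrite divfK// gt_eqF.
rewrite e'E; lra.
Qed.

End AbsoluteContinuity.

(** * Linear differential equations with absolutely continuous solutions *)

Section AbsolutelyContinuousSolutions.
Context {R : realType}.
Implicit Types (a c t : R) (s : seq (R * R)).

Definition lipschitz_segment a c (f : R -> R) := exists2 K : R, 0 <= K &
  forall t t', a <= t -> t <= t' -> t' <= c -> `|f t' - f t| <= K * (t' - t).

Lemma chain_total_increment_le (V W : normedModType R) a c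
    (f : R -> V) (g : R -> W) (K B : R) s :
  (forall t t', a <= t -> t <= t' -> t' <= c ->
     `|f t' - f t| <= K * (t' - t) + B * `|g t' - g t|) ->
  chain a c s ->
  total_increment f s <= K * total_length s + B * total_increment g s.
Proof.
move=> fg; rewrite /total_increment /total_length.
elim: s c fg => [|p s IH] c fg /=; first by rewrite !big_nil !mulr0 addr0.
move=> [p12 pc ps]; rewrite !big_cons.
have := fg _ _ (chain_le ps) p12 pc.
have /IH/(_ ps) : forall t t', a <= t -> t <= t' -> t' <= p.1 ->
    `|f t' - f t| <= K * (t' - t) + B * `|g t' - g t|.
  by move=> t t' at_ tt' t'p; apply: fg => //; rewrite (le_trans t'p)// (le_trans p12).
lra.
Qed.

Lemma ac_dominated (V W : normedModType R) a c (f : R -> V) (g : R -> W) (K B : R) :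
  0 <= K -> 0 <= B ->
  (forall t t', a <= t -> t <= t' -> t' <= c ->
     `|f t' - f t| <= K * (t' - t) + B * `|g t' - g t|) ->
  ac_segment a c g -> ac_segment a c f.
Proof.
move=> K0 B0 fg acg e e0.
have KB : 0 < K + B + 1 by rewrite ltr_wpDl// addr_ge0.
pose e' := e / (K + B + 1).
have e'0 : 0 < e' by rewrite divr_gt0.
have [d d0 hd] := acg _ e'0.
exists (Num.min d e'); first by rewrite lt_min d0.
move=> s cs; rewrite lt_min => /andP[ld le'].
apply: le_lt_trans (chain_total_increment_le fg cs) _.
have lK : K * total_length s <= K * e' by rewrite ler_wpM2l// ltW.
have lB : B * total_increment g s <= B * e' by rewrite ler_wpM2l// ltW// hd.
have -> : e = e' * (K + B + 1) by rewrite divfK// gt_eqF.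
lra.
Qed.

Lemma ac_sum a c n (f : 'I_n -> R -> R) :
  (forall i, ac_segment a c (f i)) ->
  ac_segment a c (fun t => \sum_i f i t).
Proof.
move=> acf e e0.
have n1 : 0 < n.+1%:R :> R by [].
have e'0 : 0 < e / n.+1%:R by rewrite divr_gt0.
have /choice[d hd] : forall i, exists d, 0 < d /\
    forall s, chain a c s -> total_length s < d -> total_increment (f i) s < e / n.+1%:R.
  by move=> i; have [d d0 hd] := acf i _ e'0; exists d.
exists (\big[Num.min/1]_i d i).
  by apply/bigmin_gtP; split=> // i _; case: (hd i).
move=> s cs /bigmin_gtP[_ ls].
apply: (@le_lt_trans _ _ (\sum_i total_increment (f i) s)).
  rewrite /total_increment exchange_big ler_sum//= => p _.
  by rewrite -sumrB ler_norm_sum.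
apply: (@le_lt_trans _ _ (\sum_(i < n) e / n.+1%:R)).
  apply: ler_sum => i _; rewrite ltW//; apply: (hd i).2 => //; exact: ls.
rewrite sumr_const card_ord -[_ *+ n]mulr_natr -mulrA gtr_pMr//.
by rewrite mulrC ltr_pdivrMr// mul1r ltr_nat.
Qed.

(** With d a modulus for e = 1, the value changes by less than 1 on each of the
    finitely many steps of length d / 2 that lead from a to t. *)
Lemma ac_bounded (V : normedModType R) a c (g : R -> V) : ac_segment a c g ->
  exists2 B : R, 0 <= B & forall t, a <= t -> t <= c -> `|g t| <= B.
Proof.
move=> acg; have [d d0 hd] := acg _ ltr01.
have hk (k : nat) t : a <= t -> t <= c -> t <= a + (d / 2) * k%:R ->
    `|g t| <= `|g a| + k%:R.
  elim: k t => [|k IH] t at_ tc.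
    rewrite mulr0 !addr0 => ta; have -> : t = a by apply/eqP; rewrite eq_le ta.
    by [].
  move=> tk; pose t' := Num.max a (t - d / 2).
  have d2 : 0 < d / 2 by rewrite divr_gt0.
  have t't : t' <= t by rewrite ge_max at_/= gerBl ltW.
  have at' : a <= t' by rewrite le_max lexx.
  have : t' <= a + d / 2 * k%:R.
    rewrite ge_max lerDl mulr_ge0 ?(ltW d2)//=.
    by move: tk; rewrite -natr1; lra.
  move=> /(IH _ at' (le_trans t't tc)) gt'.
  have := hd [:: (t', t)]; rewrite /total_length /total_increment !big_seq1/=.
  have tt'd : t - t' < d.
    have : t - d / 2 <= t' by rewrite le_max lexx orbT.
    lra.
  move=> /(_ (And3 t't tc at') tt'd) gtt'.
  have := ler_normD (g t - g t') (g t'); rewrite subrK -natr1; lra.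
have [ac|ac] := leP a c; last first.
  by exists 0 => // t at_ tc; have := le_lt_trans (le_trans at_ tc) ac; rewrite ltxx.
pose k := `|Num.ceil ((c - a) / (d / 2))|%N.
exists (`|g a| + k%:R); first by rewrite addr_ge0.
move=> t at_ tc; apply: hk => //.
have : (c - a) / (d / 2) <= k%:R.
  have ca : 0 <= (c - a) / (d / 2) by rewrite !divr_ge0 ?subr_ge0// ltW.
  rewrite /k natr_absz ger0_norm ?ceil_ge0// ?ceil_ge//; last by rewrite (lt_le_trans _ ca).
rewrite ler_pdivrMr ?divr_gt0//; lra.
Qed.

Lemma ac_mul_lipschitz a c (f g : R -> R) : lipschitz_segment a c f ->
  ac_segment a c g -> ac_segment a c (fun t => f t * g t).
Proof.
move=> [K K0 fK] acg; have [B B0 gB] := ac_bounded acg.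
pose C := `|f a| + K * (c - a).
have [ac|ac] := leP a c; last first.
  move=> e e0; exists 1 => // s /chain_le ac'.
  by have := le_lt_trans ac' ac; rewrite ltxx.
have C0 : 0 <= C by rewrite addr_ge0// mulr_ge0// subr_ge0.
have fC t : a <= t -> t <= c -> `|f t| <= C.
  move=> at_ tc; rewrite -(subrK (f a) (f t)) addrC.
  rewrite (le_trans (ler_normD _ _))// lerD2l (le_trans (fK _ _ _ _ _))//.
  by rewrite ler_wpM2l// lerB.
apply: (@ac_dominated _ _ a c _ g (B * K) C) => //; first by rewrite mulr_ge0.
move=> t t' at_ tt' t'c.
have -> : f t' * g t' - f t * g t = (f t' - f t) * g t + f t' * (g t' - g t) by ring.
rewrite (le_trans (ler_normD _ _))// !normrM lerD//.
  rewrite mulrC -mulrA ler_pM//; first by rewrite gB// (le_trans tt').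
  exact: fK.
by rewrite ler_wpM2r// fC// (le_trans at_).
Qed.

Lemma lipschitz_C1 a c (f f' : R -> R) :
  (forall t, is_derive t 1 f (f' t)) -> continuous f' -> lipschitz_segment a c f.
Proof.
move=> df cf'; have [ac|ac] := leP a c; last first.
  exists 0 => // t t' h1 h2 h3.
  by have := le_lt_trans (le_trans (le_trans h1 h2) h3) ac; rewrite ltxx.
have cn : {within `[a, c], continuous (fun t => `|f' t|)}.
  apply: continuous_subspaceT => t; apply: (continuous_comp (cf' t)).
  exact: norm_continuous.
have [m _ hm] := EVT_max ac cn.
exists `|f' m| => // t t' at_ tt' t'c.
have [|x] := @MVT_segment _ f f' t t' tt' (fun x _ => df x).
- apply: continuous_subspaceT => x.
  by apply/differentiable_continuous/derivable1_diffP; case: (df x).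
rewrite in_itv/= => /andP[tx xt'] ->.
rewrite normrM (ger0_norm (_ : 0 <= t' - t)) ?subr_ge0// ler_wpM2r ?subr_ge0//.
by apply: hm; rewrite in_itv/= (le_trans at_)//= (le_trans xt').
Qed.

Lemma ae_sub (P Q : R -> Prop) : (forall t, P t -> Q t) ->
  {ae (@lebesgue_measure R), forall t, P t} ->
  {ae (@lebesgue_measure R), forall t, Q t}.
Proof.
by move=> PQ [N [mN N0 PN]]; exists N; split=> // t nQ; apply: PN => /PQ.
Qed.

Lemma entry_le_norm m n (M : 'M[R]_(m, n)) i j : `|M i j| <= `|M|.
Proof.
rewrite [leRHS]/Num.Def.normr/= mx_normrE.
exact: (le_bigmax _ (fun ij => `|M ij.1 ij.2|) (i, j)).
Qed.

(** Variation of constants: exp(-(t - a) M) g(t) is absolutely continuous with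
    null derivative almost everywhere. *)
Lemma ac_linear_ode n (M : 'M[R]_n) (g : R -> 'cV[R]_n) a c : a <= c ->
  ac_segment a c g ->
  {ae (@lebesgue_measure R), forall t, a < t < c -> is_derive t 1 g (M *m g t)} ->
  g c = expmx M (c - a) *m g a.
Proof.
move=> ac acg dg.
pose P t := expmx M (- (t - a)).
have dP t : is_derive t 1 P (- (M *m P t)).
  apply/is_derive_mxP => i j.
  have /is_derive_mxP/(_ i j) h := is_derive_expmxN M (t - a).
  have := @is_derive1_comp _ (fun t => expmx M (- t) i j) (fun t => t - a) t _ _ h _.
  move=> /(_ _ (is_deriveB (is_derive_id _ _) (is_derive_cst _ _ _))).
  by rewrite subr0 mulr1.
have LP i j : lipschitz_segment a c (fun t => P t i j).
  apply: (@lipschitz_C1 _ _ _ (fun t => (- (M *m P t)) i j)).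
    by move=> t; move: (dP t) => /is_derive_mxP.
  move=> t; apply/differentiable_continuous/derivable1_diffP.
  rewrite (_ : (fun t => _) = (fun t => ((- M) *m P t) i j)); last first.
    by apply/funext => s; rewrite mulNmx.
  by have /is_derive_mxP/(_ i j)[] := is_derive_mulmx (is_derive_cst (- M) t 1) (dP t).
have Pg : P c *m g c = P a *m g a.
  apply/matrixP => i j; pose f t := (P t *m g t) i j.
  apply: (@ac_ae_derive0_cst _ a c f ac).
    rewrite /f (_ : (fun t => _) = (fun t => \sum_l P t i l * g t l j)); last first.
      by apply/funext => t; rewrite mxE.
    apply: ac_sum => l; apply: ac_mul_lipschitz => //.
    apply: (@ac_dominated _ _ a c _ g 0 1) => // t t' _ _ _.
    rewrite mul0r mul1r add0r.
    by have := entry_le_norm (g t' - g t) l j; rewrite !mxE.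
  apply: ae_sub dg => t dgt /dgt dgt'.
  have /is_derive_mxP/(_ i j) := is_derive_mulmx (dP t) dgt'.
  by rewrite /P mulNmx -expmxC !mulmxA addNr mxE.
have : expmx M (c - a) *m (P c *m g c) = expmx M (c - a) *m (P a *m g a) by rewrite Pg.
rewrite /P subrr oppr0 expmx0 mul1mx mulmxA.
by rewrite -{1}[c - a]opprK expmxNK mul1mx.
Qed.
End AbsolutelyContinuousSolutions.

(** * Trajectories of the linear system *)

Section Flow.
Context {R : realType}.

Lemma chain_nth (a c : R) s : chain a c s ->
  [/\ forall i, (i < size s)%N -> let p := nth (0, 0) s i in
        a <= p.1 /\ p.1 <= p.2 /\ p.2 <= c
    & forall i j, (i < j)%N -> (j < size s)%N ->
        (nth (0, 0) s j).2 <= (nth (0, 0) s i).1].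
Proof.
elim: s c => [|p s IH] c //= [p12 pc ps].
have [s1 s2] := IH _ ps; split.
  move=> [_|i /s1 /=[h1 [h2 h3]]]; first by rewrite (chain_le ps).
  by rewrite h1 h2 (le_trans h3)// (le_trans p12).
move=> [|i] [|j]//= ij js; last exact: s2.
by have [_ []] := s1 _ js.
Qed.

Lemma ac_on_segment n (L a c : R) (x : R -> 'cV[R]_n) :
  absolutely_continuous_on L x -> 0 <= a -> c < L -> ac_segment a c x.
Proof.
move=> acx a0 cL e e0; have [d d0 hd] := acx _ e0.
exists d => // s /chain_nth[s1 s2] ls.
have := hd (size s) (fun i => (nth (0, 0) s i).1) (fun i => (nth (0, 0) s i).2).
rewrite /total_increment (big_nth (0, 0)) big_mkord; apply.
- move=> i; have [h1 [h2 h3]] := s1 _ (ltn_ord i).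
  by rewrite h2 (le_trans a0 h1) (le_lt_trans h3).
- suff disj (i j : 'I_(size s)) : (i < j)%N ->
    `](nth (0, 0) s i).1, (nth (0, 0) s i).2[%classic `&`
    `](nth (0, 0) s j).1, (nth (0, 0) s j).2[%classic = set0.
    apply/trivIsetP => i j _ _; rewrite neq_lt => /orP[ij|ji]; first exact: disj.
    by rewrite setIC; exact: disj.
  move=> ij; apply/seteqP; split=> // z [] /=; rewrite !in_itv/= => /andP[h1 _] /andP[_ h2].
  by have := lt_trans h2 (le_lt_trans (s2 _ _ ij (ltn_ord j)) h1); rewrite ltxx.
- by move: ls; rewrite /total_length (big_nth (0, 0)) big_mkord.
Qed.

Lemma mulmx_norm_le m n p (Q : 'M[R]_(m, n)) : exists2 K : R, 0 <= K &
  forall v : 'M[R]_(n, p), `|Q *m v| <= K * `|v|.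
Proof.
exists (\sum_i \sum_j `|Q i j|) => [|v].
  by apply: sumr_ge0 => *; exact: sumr_ge0.
rewrite [leLHS]/Num.Def.normr/= mx_normrE; apply: bigmax_le => [|[i j] _ /=].
  by rewrite mulr_ge0//; apply: sumr_ge0 => *; exact: sumr_ge0.
rewrite mxE (le_trans (ler_norm_sum _ _ _))// (bigD1 i)//= mulrDl.
rewrite -[leLHS]addr0 lerD//.
  rewrite mulr_suml ler_sum// => l _; rewrite normrM ler_wpM2l//.
  exact: entry_le_norm.
by rewrite mulr_ge0//; apply: sumr_ge0 => *; exact: sumr_ge0.
Qed.

(** Applied below with the coordinates (x, u) of the held system and with the
    projection of x on a left invariant subspace of A that kills B. *)
Lemma trajectory_affine_ode n m p (A : 'M[R]_n) (B : 'M[R]_(n, m)) x0 L u x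
    (a c : R) (Q : 'M[R]_(p, n)) (b : 'cV[R]_p) (M : 'M[R]_p) :
  trajectory A B x0 L u x -> 0 <= a -> a <= c -> c < L ->
  (forall t, a < t < c -> Q *m (A *m x t + B *m u t) = M *m (Q *m x t + b)) ->
  Q *m x c + b = expmx M (c - a) *m (Q *m x a + b).
Proof.
move=> [_ acx _ dx] a0 ac cL QM.
apply: (@ac_linear_ode _ _ M (fun t => Q *m x t + b)) => //.
  have [K K0 QK] := @mulmx_norm_le _ _ 1 Q.
  apply: (@ac_dominated _ _ _ a c _ x 0 K) => //; last exact: ac_on_segment acx _ _.
  move=> t t' _ _ _; rewrite mul0r add0r.
  have -> : Q *m x t' + b - (Q *m x t + b) = Q *m (x t' - x t).
    by rewrite mulmxBr opprD addrACA subrr addr0.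
  exact: QK.
apply: ae_sub dx => t dxt tac; rewrite -QM//.
have /dxt dxt' : 0 <= t < L.
  by case/andP: tac => at_ tc; rewrite (le_trans a0) ?(ltW at_)//= (lt_trans tc).
have := is_deriveD (is_derive_mulmx (is_derive_cst Q t 1) dxt') (is_derive_cst b t 1).
by rewrite mul0mx add0r addr0.
Qed.

(** The generator of z = (x, u) while the input u is held constant. *)
Definition hold_mx n m (A : 'M[R]_n) (B : 'M[R]_(n, m)) : 'M[R]_(n + m) :=
  block_mx A B 0 0.

Lemma trajectory_hold n m (A : 'M[R]_n) (B : 'M[R]_(n, m)) x0 L u x (a c : R) mu :
  trajectory A B x0 L u x -> 0 <= a -> a <= c -> c < L ->
  (forall t, a <= t < c -> u t = mu) ->
  col_mx (x c) mu = expmx (hold_mx A B) (c - a) *m col_mx (x a) mu.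
Proof.
move=> tr a0 ac cL umu.
pose Q : 'M[R]_(n + m, n) := col_mx 1%:M 0.
have Qx v : Q *m v + col_mx 0 mu = col_mx v mu.
  by rewrite mul_col_mx mul1mx mul0mx add_col_mx addr0 add0r.
have := @trajectory_affine_ode _ _ _ _ _ _ _ _ _ a c Q (col_mx 0 mu)
  (hold_mx A B) tr a0 ac cL.
rewrite !Qx; apply => t /andP[at_ tc].
rewrite umu ?tc ?(ltW at_)// Qx mul_col_mx mul1mx mul0mx.
by rewrite mul_block_col !mul0mx addr0.
Qed.

(** Along a trajectory W x solves the autonomous equation y' = Lam y.  Started at
    0 it stays there, but controllability makes x arbitrary. *)
Lemma controllable_left_kernel n m p (A : 'M[R]_n) (B : 'M[R]_(n, m))
    (W : 'M[R]_(p, n)) (Lam : 'M[R]_p) :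
  controllable A B -> W *m A = Lam *m W -> W *m B = 0 -> W = 0.
Proof.
move=> cAB WA WB.
suff Wx x1 : W *m x1 = 0 :> 'cV[R]_p.
  apply/matrixP => i j; have := Wx (delta_mx j 0).
  by rewrite -colE => /matrixP/(_ i 0); rewrite !mxE.
have [L [tf [u [x [/andP[tf0 tfL] tr <-]]]]] := cAB 0 x1.
have := @trajectory_affine_ode _ _ _ _ _ _ _ _ _ 0 tf W 0 Lam
  tr (lexx _) (ltW tf0) tfL _.
rewrite !addr0; case: (tr) => _ _ -> _; rewrite mulmx0 mulmx0; apply => t _.
by rewrite addr0 mulmxDr !mulmxA WA WB mul0mx addr0.
Qed.
End Flow.

(** * Complex eigenvectors of a real matrix exponential *)

Section ComplexDerivative.
Context {R : realType}.
Implicit Types (lam z : R[i]) (t T : R).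

(** Complex-valued functions of a real variable are differentiated through their
    real and imaginary parts, because R[i] is normed over itself, not over R. *)
Definition is_cderive t (f : R -> R[i]) (f' : R[i]) :=
  is_derive t (1 : R) (fun s => complex.Re (f s)) (complex.Re f') /\
  is_derive t (1 : R) (fun s => complex.Im (f s)) (complex.Im f').

Lemma is_cderive_eq t f f' f'' : is_cderive t f f' -> f' = f'' -> is_cderive t f f''.
Proof. by move=> h <-. Qed.

Lemma is_cderiveM t f g f' g' : is_cderive t f f' -> is_cderive t g g' ->
  is_cderive t (fun s => f s * g s) (f' * g t + f t * g').
Proof.
move=> [fr fi] [gr gi]; split.
- have := is_deriveB (is_deriveM fr gr) (is_deriveM fi gi).
  rewrite (_ : _ - _ = (fun s => complex.Re (f s * g s))); last first.
    by apply/funext => s; rewrite !fctE; case: (f s) => a b; case: (g s).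
  move/is_derive_eq; apply.
  case: (f t) => a b; case: (g t) => c d.
  case: f' {fr fi} => a' b'; case: g' {gr gi} => c' d' /=.
  by rewrite /GRing.scale/=; ring.
- have := is_deriveD (is_deriveM fr gi) (is_deriveM fi gr).
  rewrite (_ : _ + _ = (fun s => complex.Im (f s * g s))); last first.
    by apply/funext => s; rewrite !fctE; case: (f s) => a b; case: (g s).
  move/is_derive_eq; apply.
  case: (f t) => a b; case: (g t) => c d.
  case: f' {fr fi} => a' b'; case: g' {gr gi} => c' d' /=.
  by rewrite /GRing.scale/=; ring.
Qed.

Lemma is_cderive_const_affine (f : R -> R[i]) (b : R[i]) T :
  (forall t, is_cderive t f b) -> f T = f 0 + (real_complex R T) * b.
Proof.
move=> df.
have affine (g : R -> R) (b' : R) :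
    (forall t, is_derive t (1 : R) g b') -> g T = g 0 + T * b'.
  move=> dg; apply/eqP; rewrite -subr_eq; apply/eqP.
  rewrite -[RHS]subr0 -[X in _ = _ - X](mul0r b').
  apply: (@is_derive_0_is_cst _ (fun t => g t - t * b')) => t.
  have := is_deriveB (dg t) (is_deriveM (is_derive_id t 1) (is_derive_cst b' t 1)).
  by move/is_derive_eq; apply; rewrite /GRing.scale/=; ring.
have hr := affine _ _ (fun t => (df t).1); have hi := affine _ _ (fun t => (df t).2).
move: hr hi; case: (f T) => a1 b1; case: (f 0) => a0 b0; case: b {df} => c d /= -> ->.
by apply/eqP; rewrite eq_complex/= !mul0r subr0 addr0 !eqxx.
Qed.

Definition cexp lam t : R[i] :=
  Complex (expR (complex.Re lam * t) * cos (complex.Im lam * t))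
          (expR (complex.Re lam * t) * sin (complex.Im lam * t)).

Lemma cexp0 lam : cexp lam 0 = 1.
Proof. by rewrite /cexp !mulr0 expR0 cos0 sin0 mulr0 mulr1. Qed.

Lemma is_cderive_cexp lam t : is_cderive t (cexp lam) (lam * cexp lam t).
Proof.
case: lam => a b; rewrite /cexp.
have da : is_derive t (1 : R) (fun s => expR (a * s)) (expR (a * t) * a).
  apply: (@is_derive1_comp _ expR (fun s => a * s)).
  by have := is_deriveZ a (is_derive_id t (1 : R)); rewrite [a *: 1]mulr1.
have db : is_derive t (1 : R) (fun s => b * s) b.
  by have := is_deriveZ b (is_derive_id t (1 : R)); rewrite [b *: 1]mulr1.
have dc := @is_derive1_comp _ cos _ t _ _ (is_derive_cos (b * t)) db.
have ds := @is_derive1_comp _ sin _ t _ _ (is_derive_sin (b * t)) db.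
split; rewrite /=.
- have := is_deriveM da dc => /is_derive_eq; apply.
  by rewrite /GRing.scale/=; ring.
- have := is_deriveM da ds => /is_derive_eq; apply.
  by rewrite /GRing.scale/=; ring.
Qed.

Definition complexify {m n} (M : 'M[R]_(m, n)) : 'M[R[i]]_(m, n) :=
  map_mx (real_complex R) M.

Local Notation Remx := (map_mx (@complex.Re R)).
Local Notation Immx := (map_mx (@complex.Im R)).

Lemma Remx_mul m n p (w : 'M[R[i]]_(m, n)) (M : 'M[R]_(n, p)) :
  Remx (w *m complexify M) = Remx w *m M.
Proof.
apply/matrixP => i j; rewrite !mxE (raddf_sum (@complex.Re R)).
apply: eq_bigr => l _; rewrite !mxE.
by case: (w i l) => a b /=; rewrite mulr0 subr0.
Qed.

Lemma Immx_mul m n p (w : 'M[R[i]]_(m, n)) (M : 'M[R]_(n, p)) :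
  Immx (w *m complexify M) = Immx w *m M.
Proof.
apply/matrixP => i j; rewrite !mxE (raddf_sum (@complex.Im R)).
apply: eq_bigr => l _; rewrite !mxE.
by case: (w i l) => a b /=; rewrite mulr0 add0r.
Qed.

Lemma is_cderive_row_expmx n (w : 'rV[R[i]]_n) (M : 'M[R]_n) j t :
  is_cderive t (fun s => (w *m complexify (expmx M s)) 0 j)
    ((w *m complexify M *m complexify (expmx M t)) 0 j).
Proof.
have ReE (N : 'M[R]_n) : complex.Re ((w *m complexify N) 0 j) = (Remx w *m N) 0 j.
  by rewrite -Remx_mul [RHS]mxE.
have ImE (N : 'M[R]_n) : complex.Im ((w *m complexify N) 0 j) = (Immx w *m N) 0 j.
  by rewrite -Immx_mul [RHS]mxE.
have dw (v : 'rV[R]_n) :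
    is_derive t (1 : R) (fun s => (v *m expmx M s) 0 j) ((v *m (M *m expmx M t)) 0 j).
  have /is_derive_mxP/(_ 0 j) :=
    is_derive_mulmx (is_derive_cst v t 1) (is_derive_expmx M t).
  by rewrite mul0mx add0r.
rewrite -mulmxA -map_mxM; split; rewrite ?ReE ?ImE.
- by rewrite (_ : (fun s => _) = (fun s => (Remx w *m expmx M s) 0 j))//;
    apply/funext => s; exact: ReE.
- by rewrite (_ : (fun s => _) = (fun s => (Immx w *m expmx M s) 0 j))//;
    apply/funext => s; exact: ImE.
Qed.

(** exp(-lam t) exp(tM) behaves like exp(t (M - lam)): differentiating it
    multiplies the row by M - lam. *)
Lemma is_cderive_twisted n (w : 'rV[R[i]]_n) (M : 'M[R]_n) lam j t :
  is_cderive t (fun s => cexp (- lam) s * (w *m complexify (expmx M s)) 0 j)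
    (cexp (- lam) t * ((w *m (complexify M - lam%:M)) *m complexify (expmx M t)) 0 j).
Proof.
apply: is_cderive_eq (is_cderiveM (is_cderive_cexp _ _) (is_cderive_row_expmx _ _ _ _)) _.
rewrite mulmxBr mulmxBl mul_mx_scalar -scalemxAl.
by rewrite [in RHS]mxE [X in _ * (_ + X)]mxE [X in _ * (_ + - X)]mxE; ring.
Qed.

Lemma twisted_affine n (w b : 'rV[R[i]]_n) (M : 'M[R]_n) lam T :
  (forall t, cexp (- lam) t *:
     ((w *m (complexify M - lam%:M)) *m complexify (expmx M t)) = b) ->
  cexp (- lam) T *: (w *m complexify (expmx M T)) = w + real_complex R T *: b.
Proof.
move=> wb; apply/rowP => j.
have fT := @is_cderive_const_affine
  (fun s => cexp (- lam) s * (w *m complexify (expmx M s)) 0 j) (b 0 j) T.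
rewrite [LHS]mxE [RHS]mxE [X in _ = _ + X]mxE fT //.
  by rewrite cexp0 mul1r expmx0 /complexify map_mx1 mulmx1.
by move=> t; rewrite -(wb t) [X in is_cderive _ _ X]mxE; exact: is_cderive_twisted.
Qed.

Lemma expmx_eigenvector n (w : 'rV[R[i]]_n) (M : 'M[R]_n) lam T :
  w *m (complexify M - lam%:M) = 0 ->
  cexp (- lam) T *: (w *m complexify (expmx M T)) = w.
Proof.
move=> w0; rewrite (@twisted_affine _ _ 0) ?scaler0 ?addr0// => t.
by rewrite w0 mul0mx scaler0.
Qed.

Lemma expmx_jordan n (w w1 : 'rV[R[i]]_n) (M : 'M[R]_n) lam T :
  w *m (complexify M - lam%:M) = w1 -> w1 *m (complexify M - lam%:M) = 0 ->
  cexp (- lam) T *: (w *m complexify (expmx M T)) = w + real_complex R T *: w1.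
Proof.
move=> ww1 w10; rewrite (@twisted_affine _ _ w1)// => t.
by rewrite ww1; exact: expmx_eigenvector.
Qed.

Lemma stable_eigenvector n p (K : 'M[R[i]]_(p, n)) (M : 'M[R[i]]_n) :
  stablemx K M -> K != 0 ->
  exists2 w : 'rV[R[i]]_n, w != 0 &
    (w <= K)%MS /\ exists lam, w *m (M - lam%:M) = 0.
Proof.
move=> KM K0.
have [lam /eigenvalueP[v vlam v0]] : exists lam, eigenvalue (restrictmx K M) lam.
  by apply: eigenvalue_closed; rewrite lt0n mxrank_eq0.
exists (v *m row_base K); first by rewrite mulmx_free_eq0 ?row_base_free.
split; first by rewrite (submx_trans (submxMl _ _))// eq_row_base.
exists lam; move/eigenspaceP: vlam.
rewrite sub_eigenspace_conjmx ?stablemx_row_base ?row_base_free// => /eigenspaceP.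
by rewrite mulmxBr mul_mx_scalar => ->; rewrite subrr.
Qed.

(** The eigenspace K of E = exp(TM) for z is stable under M.  By injectivity of
    lam |-> exp(lam T) on the spectrum, M has a single eigenvalue lam on K.  If
    M - lam did not vanish on K, its image of K would contain an eigenvector w1,
    the image of some w2 in K.  Then exp(-lam T) w2 E = w2 + T w1, while
    exp(-lam T) E is the identity on K; this forces T w1 = 0. *)
Lemma expmx_eigenspace n (M : 'M[R]_n) T (z : R[i]) (w : 'rV[R[i]]_n) : 0 < T ->
  (forall lam1 lam2,
     eigenvalue (complexify M) lam1 -> eigenvalue (complexify M) lam2 ->
     cexp (- lam1) T = cexp (- lam2) T -> lam1 = lam2) ->
  w != 0 -> w *m complexify (expmx M T) = z *: w ->
  exists lam, w *m (complexify M - lam%:M) = 0.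
Proof.
move=> T0 inj w0 wz; pose E := complexify (expmx M T).
pose K := eigenspace E z.
have wK : (w <= K)%MS by apply/eigenspaceP.
have KM : stablemx K (complexify M).
  by apply: comm_mx_stable_eigenspace; rewrite /comm_mx -!map_mxM expmxC.
have K0 : K != 0.
  by apply: contraNneq w0 => K0; rewrite K0 submx0 in wK.
have eig (v : 'rV_n) lam : v != 0 ->
    v *m (complexify M - lam%:M) = 0 -> eigenvalue (complexify M) lam.
  move=> v0 vl; apply/eigenvalueP; exists v => //; apply/eqP.
  by rewrite -subr_eq0 -mul_mx_scalar -mulmxBr vl.
have [v v0 [vK [lam vlam]]] := stable_eigenvector KM K0.
have cz (u : 'rV_n) mu : u != 0 -> (u <= K)%MS ->
    u *m (complexify M - mu%:M) = 0 -> cexp (- mu) T * z = 1.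
  move=> u0 /eigenspaceP uK /(@expmx_eigenvector _ _ _ _ T).
  rewrite uK scalerA -[RHS]scale1r => /eqP.
  rewrite -subr_eq0 -scalerBl scaler_eq0 (negPf u0) orbF.
  by rewrite subr_eq0 => /eqP.
exists lam.
have [|K20] := eqVneq (K *m (complexify M - lam%:M)) 0.
  by move=> K20; case/submxP: wK => d ->; rewrite -mulmxA K20 mulmx0.
have K2K : (K *m (complexify M - lam%:M) <= K)%MS.
  by rewrite mulmxBr addmx_sub// mul_mx_scalar eqmx_opp scalemx_sub.
have K2M : stablemx (K *m (complexify M - lam%:M)) (complexify M).
  rewrite -mulmxA.
  have -> : (complexify M - lam%:M) *m complexify M =
            complexify M *m (complexify M - lam%:M).
    by rewrite mulmxBl mulmxBr scalar_mxC.
  by rewrite mulmxA submxMr.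
have [w1 w10 [w1K [lam' w1lam]]] := stable_eigenvector K2M K20.
have w1K' := submx_trans w1K K2K.
have ll' : lam' = lam.
  apply: inj; [exact: eig w10 w1lam|exact: eig v0 vlam|].
  have h1 := cz _ _ w10 w1K' w1lam; have h2 := cz _ _ v0 vK vlam.
  have z0 : z != 0 by apply: contra_eq_neq h2 => ->; rewrite mulr0 eq_sym oner_eq0.
  by apply: (mulIf z0); rewrite h1 h2.
subst lam'.
case/submxP: (w1K) => d dE.
pose w2 := d *m K.
have w2w1 : w2 *m (complexify M - lam%:M) = w1 by rewrite dE mulmxA.
have w2K : (w2 <= K)%MS by rewrite submxMl.
have := expmx_jordan T w2w1 w1lam.
have /eigenspaceP -> := w2K; rewrite scalerA (cz _ _ w10 w1K' w1lam) scale1r.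
move/eqP; rewrite -subr_eq0 opprD addrA subrr sub0r oppr_eq0 scaler_eq0 (negPf w10) orbF.
by rewrite eq_complex/= (gt_eqF T0).
Qed.

End ComplexDerivative.

(** * Non-pathological sampling preserves controllability *)

Section Spectrum.
Context {R : realType}.
Implicit Types (lam z : R[i]) (T : R).

Lemma cos_eq1 (x : R) : cos x = 1 -> exists q : int, x = q%:~R * (pi *+ 2).
Proof.
move=> cx1; pose q := Num.floor (x / (pi *+ 2)).
have pi2 : 0 < pi *+ 2 :> R by rewrite mulrn_wgt0// pi_gt0.
have cosDq (k : int) y : cos (y + k%:~R * (pi *+ 2)) = cos y :> R.
  case: k => k.
    by rewrite -pmulrn mulr_natl (periodicn (@cosD2pi R)).
  rewrite NegzE mulrNz -pmulrn mulNr mulr_natl.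
  by rewrite -[in RHS](subrK (pi *+ 2 *+ k.+1) y) (periodicn (@cosD2pi R)).
exists q; pose y := x - q%:~R * (pi *+ 2).
have y0 : 0 <= y.
  by rewrite subr_ge0 -ler_pdivlMr// ge_floor.
have y2 : y < pi *+ 2.
  rewrite ltrBlDr -{1}(mul1r (pi *+ 2)) -mulrDl -ltr_pdivrMr//.
  by have := lt_succ_floor (x / (pi *+ 2)); rewrite intrD addrC.
have cy : cos y = 1 by rewrite -(cosDq q) subrK.
suff : y = 0 by move/eqP; rewrite subr_eq0 => /eqP.
have [ypi|ypi] := leP y pi.
  by apply: (@cos_inj R); rewrite ?in_itv/= ?y0 ?lexx ?pi_ge0 ?cos0.
have : pi *+ 2 - y = 0.
  apply: (@cos_inj R); rewrite ?in_itv/= ?lexx ?pi_ge0//.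
    by rewrite subr_ge0 (ltW y2)/= lerBlDr mulr2n lerD2l ltW.
  by rewrite cos0 -cosN opprB cosB cos2pi sin2pi cy !mulr1 mulr0 addr0.
by move/eqP; rewrite subr_eq0 => /eqP h; rewrite h ltxx in y2.
Qed.

(** The moduli give equal real parts, and the angle between the arguments has
    cosine 1. *)
Lemma cexp_eq lam1 lam2 T : 0 < T -> cexp lam1 T = cexp lam2 T ->
  exists q : int, lam1 - lam2 = Complex 0 (2 * q%:~R * pi / T).
Proof.
case: lam1 => a1 b1; case: lam2 => a2 b2 T0; rewrite /cexp/= => -[hc hs].
have eE (a b : R) : (expR (a * T) * cos (b * T)) ^+ 2 +
    (expR (a * T) * sin (b * T)) ^+ 2 = expR (a * T) ^+ 2.
  by rewrite !exprMn -mulrDr cos2Dsin2 mulr1.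
have e12 : expR (a1 * T) = expR (a2 * T).
  apply/eqP; rewrite -(@eqrXn2 _ 2)// ?expR_ge0//.
  by rewrite -(eE a1 b1) -(eE a2 b2) hc hs.
have a12 : a1 = a2 by have /expR_inj/mulIf := e12; apply; rewrite gt_eqF.
have eN0 : expR (a2 * T) != 0 by rewrite gt_eqF// expR_gt0.
move: hc hs; rewrite e12 => /(mulfI eN0) hc /(mulfI eN0) hs.
have [q hq] : exists q : int, (b1 - b2) * T = q%:~R * (pi *+ 2).
  by apply: cos_eq1; rewrite mulrBl cosB hc hs -!expr2 cos2Dsin2.
exists q; rewrite a12; apply/eqP; rewrite eq_complex/= subrr eqxx/=.
by apply/eqP; apply: (mulIf (lt0r_neq0 T0)); rewrite hq divfK ?gt_eqF// -mulr_natl; ring.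
Qed.

Lemma eigenvalues_exist n (A : 'M[R]_n) : exists ev, eigenvalues_of A ev.
Proof.
have [s sE] := closed_field_poly_normal (char_poly (complexify A)).
have mon := monicP (char_poly_monic (complexify A)).
rewrite mon scale1r in sE.
have sn : size s = n.
  by have := size_char_poly (complexify A); rewrite sE size_prod_XsubC => -[].
exists (fun j => nth 0 s j); rewrite /eigenvalues_of -/(complexify A) sE.
by rewrite (big_nth 0) sn big_mkord.
Qed.

Lemma eigenvalue_conj n (A : 'M[R]_n) z :
  eigenvalue (complexify A) z -> eigenvalue (complexify A) (conjc z).
Proof.
move=> /eigenvalueP[v vz v0]; apply/eigenvalueP; exists (map_mx (@conjc R) v).
  rewrite -map_mxZ -vz map_mxM; congr (_ *m _).
  by apply/matrixP => i j; rewrite !mxE; apply/eqP; rewrite eq_complex/= oppr0 !eqxx.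
apply: contra_neq v0 => /matrixP v0; apply/matrixP => i j.
by have := v0 i j; rewrite !mxE => /eqP; rewrite conjc_eq0 => /eqP.
Qed.

Lemma non_pathological_eigenvalue n (A : 'M[R]_n) T lam mu (q : nat) :
  0 < T -> non_pathological A T -> (0 < q)%N ->
  eigenvalue (complexify A) lam -> eigenvalue (complexify A) mu ->
  lam - mu <> Complex 0 (2 * q%:R * pi / T).
Proof.
move=> T0 np q0 lamA muA h; have [ev evA] := eigenvalues_exist A.
have idx z : eigenvalue (complexify A) z -> exists j, ev j = z.
  rewrite eigenvalue_root_char evA /root horner_prod => /prodf_eq0[j _].
  by rewrite !hornerE subr_eq0 => /eqP zj; exists j.
have [[j jE] [l lE]] := (idx _ lamA, idx _ muA); subst lam mu.
have [jl|jl] := pselect (j = l); last exact: np evA _ _ jl _ q0 h.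
move/eqP: h; rewrite jl subrr eq_complex/= => /andP[_].
by rewrite lt_eqF// divr_gt0// mulr_gt0 ?pi_gt0// mulr_gt0// ltr0n.
Qed.

(** If 0 and lam differed by 2 q pi i / T, then lam and its conjugate, both
    eigenvalues of the real matrix A, would differ by 2 (2 q) pi i / T. *)
Lemma non_pathological_eigenvalue0 n (A : 'M[R]_n) T lam mu (q : nat) :
  0 < T -> non_pathological A T -> (0 < q)%N ->
  lam = 0 \/ eigenvalue (complexify A) lam ->
  mu = 0 \/ eigenvalue (complexify A) mu ->
  lam - mu <> Complex 0 (2 * q%:R * pi / T).
Proof.
move=> T0 np q0; have q20 : (0 < q + q)%N by rewrite addn_gt0 q0.
have qq : 2 * (q + q)%:R * pi / T = 2 * q%:R * pi / T + 2 * q%:R * pi / T.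
  by rewrite natrD; ring.
case=> [->|lamA] [->|muA].
- move/eqP; rewrite subrr eq_complex/= => /andP[_].
  by rewrite lt_eqF// divr_gt0// mulr_gt0 ?pi_gt0// mulr_gt0// ltr0n.
- rewrite sub0r => h; have mucA := eigenvalue_conj muA.
  apply: (non_pathological_eigenvalue T0 np q20 mucA muA); rewrite qq.
  move: h; case: mu {muA mucA} => a b [_ hb].
  by apply/eqP; rewrite eq_complex/= subrr hb !eqxx.
- rewrite subr0 => h; have lamcA := eigenvalue_conj lamA.
  apply: (non_pathological_eigenvalue T0 np q20 lamA lamcA); rewrite qq h.
  by apply/eqP; rewrite eq_complex/= subrr opprK !eqxx.
- exact: non_pathological_eigenvalue T0 np q0 lamA muA.
Qed.

Lemma complexify_hold n m (A : 'M[R]_n) (B : 'M[R]_(n, m)) :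
  complexify (hold_mx A B) = block_mx (complexify A) (complexify B) 0 0.
Proof. by rewrite /complexify /hold_mx map_block_mx !map_mx0. Qed.

Lemma eigenvalue_hold n m (A : 'M[R]_n) (B : 'M[R]_(n, m)) lam :
  eigenvalue (complexify (hold_mx A B)) lam ->
  lam = 0 \/ eigenvalue (complexify A) lam.
Proof.
move=> /eigenvalueP[w]; rewrite complexify_hold -[w]hsubmxK.
set v1 := lsubmx w; set v2 := rsubmx w.
rewrite mul_row_block !mulmx0 !addr0 scale_row_mx => /eq_row_mx[h1 h2] w0.
have [v10|v10] := eqVneq v1 0; last by right; apply/eigenvalueP; exists v1.
left; apply/eqP; move/esym/eqP: h2; rewrite v10 mul0mx scaler_eq0 => /orP[//|/eqP v20].
by rewrite v10 v20 row_mx0 eqxx in w0.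
Qed.

Lemma hold_spectrum_inj n m (A : 'M[R]_n) (B : 'M[R]_(n, m)) T lam mu :
  0 < T -> non_pathological A T ->
  eigenvalue (complexify (hold_mx A B)) lam ->
  eigenvalue (complexify (hold_mx A B)) mu ->
  cexp (- lam) T = cexp (- mu) T -> lam = mu.
Proof.
move=> T0 np /eigenvalue_hold lamA /eigenvalue_hold muA /(cexp_eq T0)[q].
rewrite opprK addrC; case: q => [[|q]|q].
- by rewrite mulr0 !mul0r => /eqP; rewrite subr_eq0 => /eqP.
- by move/(non_pathological_eigenvalue0 T0 np (ltn0Sn q) muA lamA).
- rewrite NegzE mulrNz mulrN !mulNr => h.
  have {}h : lam - mu = Complex 0 (2 * q.+1%:R * pi / T).
    by rewrite -opprB h; apply/eqP; rewrite eq_complex/= oppr0 opprK !eqxx.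
  by have := non_pathological_eigenvalue0 T0 np (ltn0Sn q) lamA muA h.
Qed.

(** An eigenvector (v, 0) of exp(TM) in the complexified row space is one of M,
    so v A = lam v and v B = 0; the real and imaginary parts of v then span a
    real left invariant subspace of A that kills B. *)
Lemma sampled_left_kernel n m p (A : 'M[R]_n) (B : 'M[R]_(n, m)) T
    (V : 'M[R]_(p, n)) :
  controllable A B -> 0 < T -> non_pathological A T ->
  let VO : 'M[R]_(p, n + m) := row_mx V 0 in
  stablemx VO (expmx (hold_mx A B) T) -> V = 0.
Proof.
move=> cAB T0 np VO VE; apply/eqP/negPn/negP => V0.
have VO0 : complexify VO != 0.
  apply: contra_neq V0 => /matrixP VO0; apply/matrixP => i j.
  by have := VO0 i (lshift m j); rewrite !mxE (unsplitK (inl j)) => -[->].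
have VEc : stablemx (complexify VO) (complexify (expmx (hold_mx A B) T)).
  by rewrite /complexify -map_mxM map_submx.
have [w w0 [wV [z wz]]] := stable_eigenvector VEc VO0.
have [lam wlam] : exists lam, w *m (complexify (hold_mx A B) - lam%:M) = 0.
  apply: (@expmx_eigenspace _ _ _ T z) => //.
    by move=> lam1 lam2; exact: hold_spectrum_inj.
  by apply/eqP; rewrite -subr_eq0 -mul_mx_scalar -mulmxBr wz.
have [v wE] : exists v : 'rV_n, w = row_mx v 0.
  case/submxP: wV => d ->; exists (d *m complexify V).
  by rewrite /complexify /VO map_row_mx map_mx0 mul_mx_row mulmx0.
have v0 : v != 0 by apply: contraNneq w0 => v0; rewrite wE v0 row_mx0.
move: wlam; rewrite mulmxBr mul_mx_scalar wE complexify_hold mul_row_block !mulmx0 !addr0.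
rewrite scale_row_mx scaler0 => /eqP; rewrite subr_eq0 => /eqP/eq_row_mx[vA vB].
case: lam vA => a b vA.
(* Multiplication by a + i b on real and imaginary parts. *)
pose Lam : 'M[R]_(1 + 1) := block_mx a%:M (- b)%:M b%:M a%:M.
pose W : 'M[R]_(1 + 1, n) :=
  col_mx (map_mx (@complex.Re R) v) (map_mx (@complex.Im R) v).
have W0 : W = 0.
  apply: (controllable_left_kernel cAB (Lam := Lam)).
  - rewrite mul_col_mx -Remx_mul -Immx_mul vA mul_block_col !mul_scalar_mx.
    congr col_mx; apply/rowP => j; rewrite !mxE; case: (v 0 j) => c d /=; ring.
  - by rewrite mul_col_mx -Remx_mul -Immx_mul vB !map_mx0 col_mx0.
move/eqP: W0; rewrite col_mx_eq0 => /andP[/eqP/rowP r0 /eqP/rowP i0].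
move/eqP: v0; apply; apply/rowP => j; have := r0 j; have := i0 j.
by rewrite !mxE; case: (v 0 j) => c d /= -> ->.
Qed.
End Spectrum.

(** * Rank of the data matrix *)

Section Rank.
Context {R : realType}.

Lemma hcat_mulmx p (v : nat -> 'cV[R]_p) k (c : 'cV[R]_k) :
  hcat v k *m c = \sum_(j < k) c j 0 *: v j.
Proof.
apply/colP => i; rewrite mxE summxE; apply: eq_bigr => j _.
by rewrite !mxE mulrC.
Qed.

Lemma col_hcat p (v : nat -> 'cV[R]_p) k (j : 'I_k) : col j (hcat v k) = v j.
Proof. by apply/colP => i; rewrite !mxE. Qed.

Lemma mulmx_hcat_eq0 p q (X : 'M[R]_(q, p)) (v : nat -> 'cV[R]_p) k :
  X *m hcat v k = 0 <-> forall j, (j < k)%N -> X *m v j = 0.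
Proof.
split=> [X0 j jk|X0].
  by rewrite -(col_hcat v (Ordinal jk)) colE mulmxA X0 mul0mx.
apply/matrixP => i j; have := X0 j (ltn_ord j).
by rewrite -(col_hcat v j) colE mulmxA -colE => /matrixP/(_ i 0); rewrite !mxE.
Qed.

Context {n m : nat}.
Variables (chi : nat -> 'cV[R]_n) (mu : nat -> 'cV[R]_m).

Lemma data_matrixE k :
  data_matrix chi mu k = hcat (fun j => col_mx (chi j) (mu j)) k.
Proof.
apply/matrixP => i j; rewrite !mxE.
by case: splitP => l _; rewrite !mxE.
Qed.

(** If no annihilator had a nonzero input part, the left kernel of the previous
    states, padded by zeros, would be stable under E, hence null; the data matrix
    would then have independent rows with fewer than n + m columns. *)
Lemma informative_annihilator (E : 'M[R]_(n + m)) k :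
  (forall V : 'M[R]_n, stablemx (row_mx V 0 : 'M[R]_(n, n + m)) E -> V = 0) ->
  (forall j, (j < k)%N ->
     col_mx (chi j.+1) (mu j) = E *m col_mx (chi j) (mu j)) ->
  (k < n + m)%N -> im (hcat chi k) (chi k) ->
  exists (xi : 'cV[R]_n) (eta : 'cV[R]_m),
    eta <> 0 /\ annihilates chi mu k xi eta.
Proof.
move=> VE step kN [c _ chik]; apply: contrapT => noann.
pose D := data_matrix chi mu k.
have ann q (X : 'M[R]_(q, n + m)) : X *m D = 0 -> rsubmx X = 0.
  move=> XD; apply/row_matrixP => i; rewrite row0.
  apply: contrapT => ri; apply: noann.
  exists (lsubmx (row i X))^T, (rsubmx (row i X))^T; split.
    have rE : row i (rsubmx X) = rsubmx (row i X) by apply/rowP => l; rewrite !mxE.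
    by move=> e0; apply: ri; rewrite rE -[LHS]trmxK e0 trmx0.
  by rewrite /annihilates !trmxK hsubmxK -row_mul XD row0.
pose C := hcat chi k; pose V := kermx C; pose VO : 'M[R]_(n, n + m) := row_mx V 0.
have Vchi j : (j <= k)%N -> V *m chi j = 0.
  have VC : V *m C = 0 by rewrite mulmx_ker.
  rewrite leq_eqVlt => /orP[/eqP ->|]; first by rewrite -chik mulmxA VC mul0mx.
  exact: (mulmx_hcat_eq0 _ _ _).1 VC j.
have VOED : VO *m E *m D = 0.
  rewrite /D data_matrixE; apply/mulmx_hcat_eq0 => j jk.
  by rewrite -mulmxA -step// mul_row_col mul0mx addr0 Vchi.
have PE : VO *m E = row_mx (lsubmx (VO *m E)) 0 by rewrite -(ann _ _ VOED) hsubmxK.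
have PV : (lsubmx (VO *m E) <= V)%MS.
  apply/sub_kermxP; move: VOED; rewrite PE /D /data_matrix mul_row_col mul0mx addr0.
  by rewrite row_mxKl.
have V0 : V = 0.
  apply: VE; rewrite -/VO PE; case/submxP: PV => d ->.
  by apply/submxP; exists d; rewrite mul_mx_row mulmx0.
have freeC : row_free C by rewrite -kermx_eq0 -/C -/V V0.
have : row_free D.
  rewrite -kermx_eq0; have KD := mulmx_ker D.
  rewrite -[kermx D]hsubmxK (ann _ _ KD).
  suff -> : lsubmx (kermx D) = 0 by rewrite row_mx0.
  have := KD; rewrite -[X in X *m D]hsubmxK (ann _ _ KD) /D /data_matrix.
  rewrite mul_row_col mul0mx addr0 => /eqP.
  by rewrite mulmx_free_eq0// => /eqP.
rewrite /row_free => /eqP rD; have := rank_leq_col D.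
by rewrite rD leqNgt kN.
Qed.

(** A new column in the span of the previous ones would be annihilated by every
    (xi, eta) that annihilates these, against the choice of mu_k; and its
    upper part would put chi_k in the span of the previous states. *)
Lemma design_free k :
  (forall j, (j < k)%N -> design_step chi mu j) ->
  forall c : nat -> R, \sum_(j < k) c j *: col_mx (chi j) (mu j) = 0 ->
  forall j, (j < k)%N -> c j = 0.
Proof.
elim: k => [//|k IH] des c; rewrite big_ord_recr/= => ck0 j.
have {}IH := IH (fun j jk => des j (leqW jk)).
suff ck : c k = 0.
  rewrite ltnS leq_eqVlt => /orP[/eqP -> //|jk].
  by apply: IH jk; move: ck0; rewrite ck scale0r addr0.
apply: contrapT => /eqP ck.
have dk : col_mx (chi k) (mu k) =
    \sum_(j < k) (- (c j / c k)) *: col_mx (chi j) (mu j).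
  apply: (scalerI ck); rewrite scaler_sumr.
  move/eqP: ck0; rewrite addrC addr_eq0 => /eqP ->.
  rewrite -sumrN; apply: eq_bigr => l _.
  by rewrite scalerA mulrN mulrC divfK// scaleNr.
pose b : 'cV[R]_k := \col_(j < k) - (c j / c k).
have dk' : col_mx (chi k) (mu k) = data_matrix chi mu k *m b.
  by rewrite data_matrixE hcat_mulmx dk; apply: eq_bigr => l _; rewrite !mxE.
have := des k (ltnSn k); rewrite /design_step.
case: k b dk' {IH des ck0 ck dk} => [|k] b dk'.
  move=> mu0; apply: mu0; move: dk'; rewrite data_matrixE hcat_mulmx big_ord0.
  by rewrite -[0]col_mx0 => /eq_col_mx[].
case=> [|xi [eta [_ ann]]].
  by exists b => //; move: dk'; rewrite /data_matrix mul_col_mx => /eq_col_mx[].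
by apply; rewrite -mul_row_col dk' mulmxA ann mul0mx.
Qed.

Lemma design_rank :
  (forall k, (k < n + m)%N -> design_step chi mu k) ->
  \rank (data_matrix chi mu (n + m)) = (n + m)%N.
Proof.
move=> des; rewrite -mxrank_tr; apply/eqP; rewrite -/(row_free _) -kermx_eq0.
apply/rowV0P => v /sub_kermxP vD.
have : data_matrix chi mu (n + m) *m v^T = 0.
  by rewrite -[LHS]trmxK trmx_mul trmxK vD trmx0.
rewrite data_matrixE hcat_mulmx => v0.
pose c j := if insub j is Some i then v 0 i else 0.
have cE (j : 'I_(n + m)) : c j = v 0 j by rewrite /c valK.
apply/rowP => j; rewrite mxE -cE; apply: (design_free des) => //.
by rewrite -[RHS]v0; apply: eq_bigr => l _; rewrite cE mxE.
Qed.
End Rank.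

Theorem proposition3 (R : realType) (n m : nat)
    (A : 'M[R]_n) (B : 'M[R]_(n, m)) (hAB : controllable A B)
    (T : R) (hT : 0 < T) (hnp : non_pathological A T)
    (x0 : 'cV[R]_n) (mu : nat -> 'cV[R]_m)
    (u : R -> 'cV[R]_m) (x : R -> 'cV[R]_n)
    (htraj : trajectory A B x0 ((n + m)%:R * T) u x)
    (hu : forall (k : nat) (t : R), (k < n + m)%N -> 0 <= t < T ->
            u (t + k%:R * T) = mu k) :
  let chi : nat -> 'cV[R]_n := fun k => x (k%:R * T) in
  (forall k : nat, (0 < k < n + m)%N ->
     (forall j : nat, (j < k)%N -> design_step chi mu j) ->
     im (hcat chi k) (chi k) ->
     exists (xi : 'cV[R]_n) (eta : 'cV[R]_m),
       eta <> 0 /\ annihilates chi mu k xi eta)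
  /\
  ((forall k : nat, (k < n + m)%N -> design_step chi mu k) ->
   \rank (data_matrix chi mu (n + m)) = (n + m)%N).
Proof.
move=> chi; split=> [k /andP[_ kN] _ chik|]; last exact: design_rank.
apply: (@informative_annihilator _ _ _ _ _ (expmx (hold_mx A B) T)) => //.
  by move=> V; exact: sampled_left_kernel.
move=> j jk; have jN : (j.+1 < n + m)%N by exact: leq_ltn_trans kN.
have dT : j.+1%:R * T - j%:R * T = T by rewrite -natr1 mulrDl mul1r addrAC subrr add0r.
rewrite -[in expmx _ T]dT; apply: (trajectory_hold htraj).
- by rewrite mulr_ge0 ?ler0n ?ltW.
- by rewrite -subr_ge0 dT ltW.
- by rewrite ltr_pM2r// ltr_nat.
move=> t /andP[jt tj]; rewrite -[t](subrK (j%:R * T)); apply: hu.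
  exact: ltnW.
by rewrite subr_ge0 jt ltrBlDr -[X in _ < X + _]dT subrK.
Qed.
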